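(* Let $n$ be a nonnegative integer. For any complex number $x$ we have (i) $\displaystyle\sum_{k=0}^{[n/2]}\binom n{2k}U_{2k}\left((x-1)^{n-2k}-x^{n-2k}+(x+1)^{n-2k}\right)=x^n$; (ii) $\displaystyle\sum_{k=0}^{[n/2]}\binom n{2k}U_{2k}\left(x^{n-2k}+(x+3)^{n-2k}\right)=(x+1)^n+(x+2)^n$; (iii) $\displaystyle\sum_{k=0}^{[n/2]}\binom n{2k}U_{2k}\left((x+3)^{n-2k}-(x-3)^{n-2k}\right)=(x+2)^n+(x+1)^n-(x-1)^n-(x-2)^n$.
   Context: $[x]$ is the greatest integer not exceeding $x$. The sequence $\{U_n\}_{n\ge0}$ is defined by $U_0=1$ and $U_n=-2\sum_{k=1}^{[n/2]}\binom n{2k}U_{n-2k}$ for $n\ge1$. The convention $0^0=1$ is used. *)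

(* Defs.v *)
From mathcomp Require Import all_boot all_order all_algebra.
From mathcomp Require Import reals complex.

Set Implicit Arguments.
Unset Strict Implicit.
Unset Printing Implicit Defensive.

Import GRing.Theory.
Local Open Scope ring_scope.

(* Course-of-values recursion: U_prefix n = [:: U_0; ...; U_n]. *)
Fixpoint U_prefix (n : nat) : seq int :=
  if n is m.+1 then
    let s := U_prefix m in
    rcons s (- 2 * \sum_(1 <= k < n./2.+1) ('C(n, 2 * k))%:Z * s`_(n - 2 * k))
  else [:: 1].

Definition U (n : nat) : int := (U_prefix n)`_n.

Lemma size_U_prefix n : size (U_prefix n) = n.+1.
Proof. by elim: n => //= n IHn; rewrite size_rcons IHn. Qed.

Lemma nth_U_prefix m n : (m <= n)%N -> (U_prefix n)`_m = U m.
Proof.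
elim: n => [|n IHn]; first by rewrite leqn0 => /eqP ->.
rewrite leq_eqVlt => /predU1P[-> //|]; rewrite ltnS => le_mn.
by rewrite /= nth_rcons size_U_prefix ltnS le_mn IHn.
Qed.

Lemma U0 : U 0 = 1.
Proof. by []. Qed.

Lemma U_rec n : (1 <= n)%N ->
  U n = - 2 * \sum_(1 <= k < n./2.+1) ('C(n, 2 * k))%:Z * U (n - 2 * k).
Proof.
case: n => // n _; rewrite {1}/U /= nth_rcons size_U_prefix ltnn eqxx.
congr (_ * _); apply: eq_big_nat => k /andP[k_gt0 _]; congr (_ * _).
by apply: nth_U_prefix; case: k k_gt0 => // k _; rewrite mulnS subSS leq_subr.
Qed.

(* Main.v *)
Require Import Defs.
From mathcomp Require Import all_boot all_order all_algebra.
From mathcomp Require Import reals complex.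
From mathcomp Require Import ring zify.

(** With [c j = 1 + (-1)^j - 0^j], the coefficients of [2 cosh t - 1], the
recurrence for [U] says that the binomial convolution of [U] and [c] is the
unit sequence. Expanding [(x-1)^m - x^m + (x+1)^m] with coefficients [c]
and regrouping by the total degree therefore leaves only [x^n], which is (i).
Adding (i) at [x+1] and [x+2] telescopes to (ii), and subtracting (ii) at
[x-3] from (ii) at [x] gives (iii). *)

Set Implicit Arguments.
Unset Strict Implicit.
Unset Printing Implicit Defensive.

Import GRing.Theory.
Local Open Scope ring_scope.
Local Open Scope complex_scope.

(** Multiplied by [k! (s - k)! (n - s)!], both sides become [n!]. In [sum_U_shift] this turns a
    product of binomials into one depending on the total degree [s] and one inside the
    convolution. *)
Lemma mul_bin_bin n k s : (k <= s <= n)%N ->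
  ('C(n, k) * 'C(n - k, s - k) = 'C(n, s) * 'C(s, k))%N.
Proof.
case/andP=> le_ks le_sn.
have fact3_gt0 : (0 < k`! * (s - k)`! * (n - s)`!)%N.
  by rewrite !muln_gt0 !fact_gt0.
apply/eqP; rewrite -(eqn_pmul2r fact3_gt0); apply/eqP.
have e1 := bin_fact (leq_trans le_ks le_sn).
have e2 : ('C(n - k, s - k) * ((s - k)`! * (n - s)`!) = (n - k)`!)%N.
  by rewrite -(bin_fact (leq_sub2r k le_sn)); congr (_ * (_ * _`!))%N; lia.
have e3 := bin_fact le_sn.
have e4 := bin_fact le_ks.
transitivity n`!; first by rewrite -e1 -e2; ring.
by rewrite -e3 -e4; ring.
Qed.

(** By induction on [n]: passing to [n.+1] gives the left side a new term exactly when [n] is odd;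
    otherwise the term added on the right is zero. *)
Lemma sum_even_terms (V : nmodType) (F : nat -> V) n :
  (forall i, odd i -> F i = 0) ->
  \sum_(0 <= k < n./2.+1) F (2 * k)%N = \sum_(0 <= i < n.+1) F i.
Proof.
move=> F_odd; elim: n => [|n IHn]; first by rewrite !big_nat1.
rewrite [RHS]big_nat_recr //= uphalf_half -IHn.
case: (boolP (odd n)) => n_odd /=; last first.
  by rewrite add0n F_odd ?addr0 //= n_odd.
rewrite add1n big_nat_recr //=; congr (_ + F _).
by rewrite -{2}(odd_double_half n) n_odd; lia.
Qed.

(** The recurrence lowers the index by positive even amounts, so an odd index leads only to smaller
    odd ones. *)
Lemma U_odd n : odd n -> U n = 0.
Proof.
elim/ltn_ind: n => n IHn n_odd.
rewrite U_rec; last by case: n n_odd {IHn}.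
rewrite big_nat_cond big1 ?mulr0 // => k; rewrite andbT => /andP[k_gt0 k_le].
by rewrite IHn ?mulr0 //; lia.
Qed.

Definition cosh_coef (j : nat) : int := 1 + (-1) ^+ j - (j == 0)%:R.

Lemma cosh_coef_odd j : odd j -> cosh_coef j = 0.
Proof. by case: j => // j j_odd; rewrite /cosh_coef -signr_odd j_odd. Qed.

(** After reversal the summation index is the argument of [cosh_coef], so only even indices survive.
    For [s > 0] the recurrence says that the term [U s] at index 0 cancels the others. *)
Lemma U_cosh_convolution s :
  \sum_(0 <= k < s.+1) 'C(s, k)%:Z * U k * cosh_coef (s - k) = (s == 0)%:R.
Proof.
rewrite big_nat_rev /= add0n.
under eq_big_nat => k /andP[_ k_le].
  rewrite subSS subKn // bin_sub //; over.
rewrite -(@sum_even_terms _ (fun k => 'C(s, k)%:Z * U (s - k) * cosh_coef k));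
  last by move=> k k_odd; rewrite cosh_coef_odd ?mulr0.
rewrite big_nat_recl // muln0 bin0 subn0.
have [->|s_gt0] := posnP s; first by rewrite big_geq // U0.
rewrite (U_rec s_gt0) big_add1 /= mulr_sumr.
rewrite mul1r mulr_suml -big_split /=.
rewrite big1 // => k _.
(* The coefficient is 1 at 0 and 2 at positive even indices, the latter matching the factor -2 of
   the recurrence. *)
rewrite /cosh_coef expr0 eqxx mulnS /= exprD exprM sqrrN !expr1n.
by move: (_%:Z) (U _) => a b; ring.
Qed.


Lemma shift_sum_expansion (A : comNzRingType) (x : A) m :
  (x - 1) ^+ m - x ^+ m + (x + 1) ^+ m =
  \sum_(0 <= j < m.+1) 'C(m, j)%:R * (cosh_coef j)%:~R * x ^+ (m - j).
Proof.
rewrite !exprDn !big_mkord.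
(* Writing [x ^+ m] as a binomial sum supported at [j = 0] lets the three expansions combine term by
   term. *)
have -> : x ^+ m = \sum_(j < m.+1) x ^+ (m - j) * (j == 0 :> nat)%:R *+ 'C(m, j).
  rewrite big_ord_recl /= subn0 bin0 mulr1 big1 ?addr0 // => j _.
  by rewrite mulr0 mul0rn.
rewrite -sumrB -big_split; apply: eq_bigr => j _ /=.
rewrite /cosh_coef rmorphB rmorphD rmorphXn rmorphN rmorph1 rmorph_nat.
by rewrite expr1n -mulrnBl -mulrnDl -mulr_natl; ring.
Qed.

Lemma sum_U_shift (A : comNzRingType) n (x : A) :
  \sum_(0 <= k < n.+1) 'C(n, k)%:R * (U k)%:~R *
    ((x - 1) ^+ (n - k) - x ^+ (n - k) + (x + 1) ^+ (n - k)) = x ^+ n.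
Proof.
(* Here [s = k + j], where [j] is the index in [shift_sum_expansion]; the power of [x] depends on
   [s] alone. *)
pose G k s : A := 'C(n, s)%:R * x ^+ (n - s) *
  ('C(s, k)%:Z * U k * cosh_coef (s - k))%:~R.
transitivity (\sum_(0 <= k < n.+1) \sum_(0 <= s < n.+1 | (k <= s)%N) G k s).
  apply: eq_big_nat => k /andP[_ k_le].
  (* The condition [k <= s] becomes the lower bound of the sum, and shifting by [k] replaces [s] by
     [j + k]. *)
  rewrite -[RHS](@big_nat_widenl _ _ _ k 0 n.+1 xpredT) //.
  rewrite -[X in index_iota X]add0n big_addn subSn //.
  rewrite shift_sum_expansion mulr_sumr; apply: eq_big_nat => j /andP[_ j_le].
  have le_kjn : (k <= j + k <= n)%N by lia.
  have := congr1 (fun m => m%:R : A) (mul_bin_bin le_kjn).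
  rewrite addnK !natrM /G addnK !rmorphM /= -pmulrn.
  rewrite -subnDA [(k + j)%N]addnC => eC.
  transitivity (('C(n, k)%:R * 'C(n - k, j)%:R) * (U k)%:~R *
    (cosh_coef j)%:~R * x ^+ (n - (j + k))); first by ring.
  by rewrite eC; ring.
(* With [s] outermost, the inner sum over [k <= s] is the convolution of [U] and [cosh_coef], so
   only [s = 0] remains. *)
rewrite (exchange_big_dep_nat xpredT) //=.
transitivity (\sum_(0 <= s < n.+1) 'C(n, s)%:R * x ^+ (n - s) * (s == 0)%:R : A).
  apply: eq_big_nat => s /andP[_ s_le].
  rewrite -mulr_sumr -rmorph_sum /=; congr (_ * _).
  rewrite -[RHS](rmorph_nat (intmul 1)) -U_cosh_convolution.
  by rewrite (big_nat_widen _ _ _ _ _ s_le).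
rewrite big_nat_recl // subn0 bin0 mulr1 mul1r big1 ?addr0 // => s _.
by rewrite mulr0.
Qed.

(** The odd-index terms missing from this sum vanish by [U_odd]. *)
Lemma sum_even_U_shift (A : comNzRingType) n (x : A) :
  \sum_(0 <= k < n./2.+1) 'C(n, 2 * k)%:R * (U (2 * k))%:~R *
    ((x - 1) ^+ (n - 2 * k) - x ^+ (n - 2 * k) + (x + 1) ^+ (n - 2 * k))
    = x ^+ n.
Proof.
rewrite -[RHS]sum_U_shift -[RHS]sum_even_terms // => k /U_odd ->.
by rewrite mulr0 mul0r.
Qed.

Lemma sum_even_U_shift3 (A : comNzRingType) n (x : A) :
  \sum_(0 <= k < n./2.+1) 'C(n, 2 * k)%:R * (U (2 * k))%:~R *
    (x ^+ (n - 2 * k) + (x + 3) ^+ (n - 2 * k)) = (x + 1) ^+ n + (x + 2) ^+ n.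
Proof.
rewrite -(sum_even_U_shift n (x + 1)) -(sum_even_U_shift n (x + 2)) -big_split.
apply: eq_bigr => k _ /=.
have -> : x + 1 - 1 = x by ring.
have -> : x + 1 + 1 = x + 2 by ring.
have -> : x + 2 - 1 = x + 1 by ring.
have -> : x + 2 + 1 = x + 3 by ring.
by ring.
Qed.

Lemma sum_even_U_diff3 (A : comNzRingType) n (x : A) :
  \sum_(0 <= k < n./2.+1) 'C(n, 2 * k)%:R * (U (2 * k))%:~R *
    ((x + 3) ^+ (n - 2 * k) - (x - 3) ^+ (n - 2 * k))
    = (x + 2) ^+ n + (x + 1) ^+ n - (x - 1) ^+ n - (x - 2) ^+ n.
Proof.
have := sum_even_U_shift3 n (x - 3).
have -> : x - 3 + 3 = x by ring.
have -> : x - 3 + 1 = x - 2 by ring.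
have -> : x - 3 + 2 = x - 1 by ring.
move=> e; transitivity ((x + 1) ^+ n + (x + 2) ^+ n -
  ((x - 2) ^+ n + (x - 1) ^+ n)); last by ring.
rewrite -e -sum_even_U_shift3 -sumrB; apply: eq_bigr => k _.
by ring.
Qed.

Theorem theorem2p3 (R : realType) (n : nat) (x : R[i]) :
  [/\ \sum_(0 <= k < n./2.+1) 'C(n, 2 * k)%:R * (U (2 * k))%:~R *
        ((x - 1) ^+ (n - 2 * k) - x ^+ (n - 2 * k) + (x + 1) ^+ (n - 2 * k))
        = x ^+ n,
      \sum_(0 <= k < n./2.+1) 'C(n, 2 * k)%:R * (U (2 * k))%:~R *
        (x ^+ (n - 2 * k) + (x + 3) ^+ (n - 2 * k))
        = (x + 1) ^+ n + (x + 2) ^+ n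
    & \sum_(0 <= k < n./2.+1) 'C(n, 2 * k)%:R * (U (2 * k))%:~R *
        ((x + 3) ^+ (n - 2 * k) - (x - 3) ^+ (n - 2 * k))
        = (x + 2) ^+ n + (x + 1) ^+ n - (x - 1) ^+ n - (x - 2) ^+ n].
Proof.
split; [exact: sum_even_U_shift | exact: sum_even_U_shift3 |].
exact: sum_even_U_diff3.
Qed.
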